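(* Fix $d\ge2$. There is a constant $C_d>0$ such that the following holds. Let $\lambda,\mu$ be partitions with at most $d$ parts, $\mu\subseteq\lambda$, and let $\mathcal{B}$ be an interval decomposition of $\{1,\ldots,d\}$. Set $\ell_i=\lambda_i+d-i$ and $m_i=\mu_i+d-i$. Then $$\frac{s_\mu(\ell_1,\ldots,\ell_d)}{\ell_1^{\mu_1}\cdots\ell_d^{\mu_d}}\le C_d\prod_{\substack{1\le i<j\le d\\ i\sim j}}\bigl(m_i-m_j+N(\ell,\mathcal{B})\bigr)\prod_{\substack{1\le i<j\le d\\ i\not\sim j}}\frac{\ell_i}{\ell_i-\ell_j}.$$
   Context: An interval decomposition of $\{1,\ldots,d\}$ is a tuple $\mathcal{B}=(B_1,\ldots,B_r)$, $r\ge1$, with $B_k=\{b_{k-1}+1,\ldots,b_k\}$ for some $0=b_0<b_1<\cdots<b_r=d$. Write $i\sim j$ if $i,j$ lie in the same block and $i\not\sim j$ otherwise. $N(\ell,\mathcal{B})=\max\{\ell_i/(\ell_i-\ell_j):1\le i<j\le d,\ i\not\sim j\}$, and $N(\ell,\mathcal{B})=0$ if $r=1$. $s_\mu$ is the Schur polynomial in $d$ variables: $s_\mu(x_1,\ldots,x_d)=\sum_T\prod_{(i,j)\in\mu}x_{T(i,j)}$ over semistandard Young tableaux $T$ of shape $\mu$ with entries in $\{1,\ldots,d\}$; convention $0^0=1$. *)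

(* Defs.v *)
From HB Require Import structures.
From mathcomp Require Import all_boot all_order all_algebra.

Set Implicit Arguments.
Unset Strict Implicit.
Unset Printing Implicit Defensive.

Import Order.TTheory GRing.Theory Num.Theory.

(* Indices 1, ..., d are represented by 'I_d, i.e. shifted down by one; the    *)
(* part lambda_(i+1) of a partition is nth 0 la i, which is 0 past the end.    *)

Definition is_part (la : seq nat) : bool := sorted geq la && (0 \notin la).

Definition part_incl (mu la : seq nat) : Prop :=
  forall i : nat, nth 0 mu i <= nth 0 la i.

(* lambda_k + d - k with k = i + 1; the subtraction never truncates. *)
Definition shifted (d : nat) (la : seq nat) (i : 'I_d) : nat :=
  nth 0 la i + (d - i.+1).

(* b lists b_1, ..., b_r; block k is {b_(k-1) + 1, ..., b_k}, which is         *)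
(* {b_(k-1), ..., b_k - 1} with indices counted from 0.                        *)
Definition interval_decomp (d : nat) (B : seq {set 'I_d}) : Prop :=
  exists b : seq nat,
    [/\ 0 < size b, path ltn 0 b, last 0 b = d
      & B = pairmap (fun m n => [set i : 'I_d | m <= i < n]) 0 b].

Definition same_block (d : nat) (B : seq {set 'I_d}) (i j : 'I_d) : bool :=
  has (fun A : {set 'I_d} => (i \in A) && (j \in A)) B.

Definition cell (mu : seq nat) : finType := {i : 'I_(size mu) & 'I_(nth 0 mu i)}.

Definition cell_row (mu : seq nat) (c : cell mu) : nat := tag c.
Definition cell_col (mu : seq nat) (c : cell mu) : nat := tagged c.

Definition is_ssyt (d : nat) (mu : seq nat) (T : {ffun cell mu -> 'I_d}) : bool :=
  [forall c : cell mu, forall c' : cell mu,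
     ((cell_row c == cell_row c') && (cell_col c < cell_col c') ==> (T c <= T c'))
  && ((cell_col c == cell_col c') && (cell_row c < cell_row c') ==> (T c < T c'))].

Local Open Scope ring_scope.

Definition schur (R : comNzRingType) (d : nat) (mu : seq nat) (x : 'I_d -> R) : R :=
  \sum_(T : {ffun cell mu -> 'I_d} | is_ssyt T) \prod_(c : cell mu) x (T c).

(* For the strictly decreasing nonnegative ell used here all the quotients are *)
(* positive, so starting the maximum at 0 only matters when no pair i < j is   *)
(* separated by B, i.e. when B has a single block.                             *)
Definition Nmax (R : realFieldType) (d : nat) (ell : 'I_d -> R)
    (B : seq {set 'I_d}) : R :=
  \big[Num.max/0]_(i < d) \big[Num.max/0]_(j < d | (i < j)%N && ~~ same_block B i j)
    (ell i / (ell i - ell j)).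

(* Main.v *)
(* Let a_ik be the number of entries k in row i of a tableau T, and q_ik = x_k / x_i.
   Then x^T / x^mu = prod_(i<k) q_ik^(a_ik), T is determined by the a_ik with i < k,
   and only the factors with i, k in different blocks are kept (the others are <= 1).
   If i < k lie in a block with last element b, put j = i + 1 + b - k.  Column
   strictness gives a_ik <= mu_i - mu_j + c_j, where c_j is the number of entries of
   row j beyond the block, i.e. the sum of the a_jl with l > b.  As k runs over the part
   of the block after i, so does j; hence once the separated a_jl are fixed, at most
   prod_(i<j, i~j) (m_i - m_j + c_j) tableaux remain.  Finally
   m_i - m_j + c_j <= (m_i - m_j + N) prod_l (1 + a_jl (1 - q_jl)), and the sum over the
   separated counts factors into geometric moments
   sum_a q^a (1 + a (1 - q))^D = O_D(1 / (1 - q)), where 1 / (1 - q_ik) is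
   x_i / (x_i - x_k). *)
Require Import Defs.
From HB Require Import structures.
From mathcomp Require Import all_boot all_order all_algebra.
From mathcomp Require Import zify ring lra.
Import Order.TTheory GRing.Theory Num.Theory.
Set Implicit Arguments.
Unset Strict Implicit.
Unset Printing Implicit Defensive.

(** * Cells and rows of a Young diagram *)

Lemma part_nth_anti (mu : seq nat) (i j : nat) :
  is_part mu -> i <= j -> nth 0 mu j <= nth 0 mu i.
Proof.
case/andP=> mu_sorted _ le_ij.
have [lt_j|le_j] := ltnP j (size mu); last by rewrite (nth_default _ le_j).
have geq_trans : transitive geq by move=> a b c /= ab bc; apply: leq_trans bc ab.
have geq_refl : reflexive geq by move=> a /=.
by apply: (sorted_leq_nth geq_trans geq_refl) => //; rewrite inE //; lia.
Qed.

Lemma cell_col_lt (mu : seq nat) (c : cell mu) :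
  cell_col c < nth 0 mu (cell_row c).
Proof. exact: ltn_ord. Qed.

Lemma cell_exists (mu : seq nat) (r y : nat) : y < nth 0 mu r ->
  exists2 c : cell mu, cell_row c = r & cell_col c = y.
Proof.
move=> lt_y; have lt_r : r < size mu.
  by rewrite ltnNge; apply/negP => le_r; rewrite nth_default in lt_y.
by exists (Tagged (fun i : 'I_(size mu) => 'I_(nth 0 mu i))
             (Ordinal (lt_y : y < nth 0 mu (Ordinal lt_r)))).
Qed.

Lemma cell_eq (mu : seq nat) (c c' : cell mu) :
  cell_row c = cell_row c' -> cell_col c = cell_col c' -> c = c'.
Proof.
case: c c' => [i y] [i' y'] /= /val_inj; rewrite /cell_row /=.
by move=> eq_i; move: y; rewrite eq_i => y eq_y; congr existT; apply: val_inj.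
Qed.

Definition row_cells (mu : seq nat) (r : nat) : {set cell mu} :=
  [set c | cell_row c == r].

Lemma card_row_cells (mu : seq nat) (r : nat) : #|row_cells mu r| = nth 0 mu r.
Proof.
have [lt_r|le_r] := ltnP r (size mu); last first.
  rewrite nth_default //; apply/eqP; rewrite cards_eq0; apply/eqP/setP => c.
  by rewrite !inE; apply/eqP => eq_r; have := ltn_ord (tag c); rewrite -/(cell_row c); lia.
pose f (y : 'I_(nth 0 mu (Ordinal lt_r))) : cell mu :=
  Tagged (fun i : 'I_(size mu) => 'I_(nth 0 mu i)) y.
have f_inj : injective f.
  by move=> y y' eq_f; apply: val_inj; have := congr1 (@cell_col mu) eq_f.
rewrite -[RHS]card_ord -[RHS](card_imset _ f_inj); apply: eq_card => c.
rewrite inE; apply/eqP/imsetP => [eq_r|[y _ ->] //].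
have lt_c : cell_col c < nth 0 mu (Ordinal lt_r) by rewrite /= -eq_r cell_col_lt.
by exists (Ordinal lt_c) => //; apply: cell_eq.
Qed.

(** * Semistandard tableaux and their entry counts *)

Definition entry_count (d : nat) (mu : seq nat) (T : {ffun cell mu -> 'I_d})
    (r : nat) (Q : pred 'I_d) : nat :=
  #|[set c in row_cells mu r | Q (T c)]|.

Lemma entry_count_sum (d : nat) (mu : seq nat) (T : {ffun cell mu -> 'I_d})
    (r : nat) (Q : pred 'I_d) :
  entry_count T r Q = \sum_(k < d | Q k) entry_count T r (pred1 k).
Proof.
rewrite /entry_count -sum1_card (partition_big T Q) /=; last first.
  by move=> c; rewrite !inE => /andP[].
apply: eq_bigr => k Qk; rewrite -sum1_card; apply: eq_bigl => c.
by rewrite !inE; case: (T c =P k) => [->|_]; rewrite ?Qk ?andbT ?andbF.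
Qed.

Lemma ssyt_row (d : nat) (mu : seq nat) (T : {ffun cell mu -> 'I_d})
    (c c' : cell mu) : is_ssyt T ->
  cell_row c = cell_row c' -> cell_col c <= cell_col c' -> T c <= T c'.
Proof.
move=> /forallP/(_ c)/forallP/(_ c')/andP[/implyP row_le _] eq_r.
rewrite leq_eqVlt => /orP[/eqP eq_c|lt_c]; first by rewrite (cell_eq eq_r eq_c).
by apply: row_le; rewrite eq_r eqxx.
Qed.

(** Induction down the column, one row at a time; the intermediate cells exist because the rows of a
    partition shrink downwards. *)
Lemma ssyt_col (d : nat) (mu : seq nat) (T : {ffun cell mu -> 'I_d})
    (c c' : cell mu) : is_part mu -> is_ssyt T ->
  cell_col c = cell_col c' -> cell_row c <= cell_row c' ->
  T c + (cell_row c' - cell_row c) <= T c'.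
Proof.
move=> mu_part T_ssyt.
move def_n: (cell_row c' - cell_row c) => n.
elim: n c' def_n => [|n IHn] c' def_n eq_c le_r.
  by rewrite addn0 (@cell_eq _ c c') //; lia.
have lt_c : cell_col c < nth 0 mu (cell_row c').-1.
  by rewrite eq_c (leq_trans (cell_col_lt c')) // part_nth_anti //; lia.
have [c1 c1_row c1_col] := cell_exists lt_c.
have le_c1 := IHn c1 ltac:(lia) (esym c1_col) ltac:(lia).
have /forallP/(_ c1)/forallP/(_ c')/andP[_ /implyP col_lt] := T_ssyt.
have : T c1 < T c' by apply: col_lt; rewrite c1_col eq_c eqxx; lia.
lia.
Qed.

Lemma ssyt_ge_row (d : nat) (mu : seq nat) (T : {ffun cell mu -> 'I_d})
    (c : cell mu) : is_part mu -> is_ssyt T -> cell_row c <= T c.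
Proof.
move=> mu_part T_ssyt.
have lt_c : cell_col c < nth 0 mu 0.
  by rewrite (leq_trans (cell_col_lt c)) // part_nth_anti.
have [c0 c0_row c0_col] := cell_exists lt_c.
have := ssyt_col mu_part T_ssyt c0_col; rewrite c0_row; lia.
Qed.

(** If [T c < T' c], a cell of this row with [T]-entry above [T c] lies strictly right of [c], so
    its [T']-entry is above [T c] too, and [c] is one more such cell for [T']. Yet the counts agree
    for all values above [T c], since [T c] is at least the row index. *)
Lemma ssyt_le_of_entry_count (d : nat) (mu : seq nat)
    (T T' : {ffun cell mu -> 'I_d}) (c : cell mu) :
  is_part mu -> is_ssyt T -> is_ssyt T' ->
  (forall (r : nat) (k : 'I_d), r < k ->
     entry_count T r (pred1 k) = entry_count T' r (pred1 k)) ->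
  T' c <= T c.
Proof.
move=> mu_part T_ssyt T'_ssyt eq_count; rewrite leqNgt; apply/negP => lt_c.
pose Q := [pred k : 'I_d | T c < k].
have : entry_count T (cell_row c) Q = entry_count T' (cell_row c) Q.
  rewrite entry_count_sum [RHS]entry_count_sum; apply: eq_bigr => k; rewrite inE => lt_k.
  apply: eq_count; exact: leq_ltn_trans (ssyt_ge_row _ _ _) lt_k.
apply/eqP; rewrite neq_ltn; apply/orP; left.
apply/proper_card/properP; split; last first.
  by exists c; rewrite !inE eqxx //= ltnn.
apply/subsetP => c1; rewrite !inE => /andP[/eqP eq_r lt_c1]; rewrite eq_r eqxx /=.
apply: leq_trans lt_c _; apply: ssyt_row => //; rewrite leqNgt; apply/negP => lt_col.
by have := ssyt_row T_ssyt eq_r (ltnW lt_col); lia.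
Qed.

Lemma ssyt_entry_count_inj (d : nat) (mu : seq nat)
    (T T' : {ffun cell mu -> 'I_d}) :
  is_part mu -> is_ssyt T -> is_ssyt T' ->
  (forall (r : nat) (k : 'I_d), r < k ->
     entry_count T r (pred1 k) = entry_count T' r (pred1 k)) ->
  T = T'.
Proof.
move=> mu_part T_ssyt T'_ssyt eq_count; apply/ffunP => c; apply/val_inj/eqP.
rewrite eqn_leq !ssyt_le_of_entry_count // => r k lt_k; exact: esym (eq_count _ _ _).
Qed.

(* In a column whose entry in row j is below the exclusive block end [e], column
   strictness forces the entry in row i to be at most e - 1 - (j - i) = k - 1. *)
Lemma ssyt_entry_count_le (d : nat) (mu : seq nat) (T : {ffun cell mu -> 'I_d})
    (i e : nat) (k : 'I_d) (j := i + (e - k)) :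
  is_part mu -> is_ssyt T -> i < k < e ->
  entry_count T i (pred1 k)
    <= nth 0 mu i - nth 0 mu j + entry_count T j [pred l : 'I_d | e <= l].
Proof.
move=> mu_part T_ssyt /andP[lt_ik lt_ke].
have le_mu : nth 0 mu j <= nth 0 mu i by apply: part_nth_anti => //; lia.
pose A := [set c in row_cells mu i | T c == k].
pose D := [set c in row_cells mu j | T c < e].
have split_j : #|D| + entry_count T j [pred l : 'I_d | e <= l] = nth 0 mu j.
  rewrite -card_row_cells -(cardsID [set c | T c < e] (row_cells mu j)).
  congr (_ + _); apply: eq_card => c; rewrite !inE //=.
  by rewrite -leqNgt andbC.
(* The cells of [A] and [D] occupy disjoint sets of columns, all of them columns of row [i]. *)
suff: #|A| + #|D| <= nth 0 mu i by rewrite /entry_count -/A in split_j *; lia.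
pose col (c : cell mu) : 'I_(nth 0 mu 0).+1 := inord (cell_col c).
have colE c : col c = cell_col c :> nat.
  rewrite inordK // ltnS ltnW // (leq_trans (cell_col_lt c)) //.
  exact: part_nth_anti.
have col_inj r : {in row_cells mu r &, injective col}.
  move=> c c'; rewrite !inE => /eqP cr /eqP c'r /(congr1 val) /=; rewrite !colE.
  by apply: cell_eq; rewrite cr c'r.
rewrite -card_row_cells -(card_in_imset (@col_inj i)).
have -> : #|A| = #|col @: A|.
  rewrite card_in_imset // => c c'; rewrite !inE => /andP[cr _] /andP[c'r _].
  by apply: (@col_inj i); rewrite inE.
have -> : #|D| = #|col @: D|.
  rewrite card_in_imset // => c c'; rewrite !inE => /andP[cr _] /andP[c'r _].
  by apply: (@col_inj j); rewrite inE.
have above c : c \in D -> exists2 c0, c0 \in row_cells mu i & col c0 = col c /\ T c0 < k.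
  rewrite !inE => /andP[/eqP cr lt_e].
  have lt_c : cell_col c < nth 0 mu i.
    by apply: leq_trans le_mu; rewrite -cr cell_col_lt.
  have [c0 c0_row c0_col] := cell_exists lt_c; exists c0; first by rewrite inE c0_row.
  split; first by rewrite /col c0_col.
  by have := ssyt_col mu_part T_ssyt c0_col; rewrite c0_row cr /j; lia.
have AD0 : [disjoint col @: A & col @: D].
  rewrite -setI_eq0; apply/eqP/setP => y; rewrite inE in_set0; apply/negP.
  case/andP=> /imsetP[c]; rewrite !inE => /andP[cr /eqP Tc] -> /imsetP[c' /above[c0 c0r [<- lt_k]]].
  move/(@col_inj i) => eq_c; have Tc0 : T c0 = k by rewrite -eq_c // inE.
  by rewrite Tc0 ltnn in lt_k.
rewrite -cardsUI (disjoint_setI0 AD0) cards0 addn0.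
apply/subset_leq_card/subsetP => y; rewrite inE => /orP[] /imsetP[c].
  by rewrite inE => /andP[cr _] ->; apply: imset_f.
by case/above=> c0 c0r [<- _] ->; apply: imset_f.
Qed.

(** * Block ends of an interval decomposition *)

(* [e i] is the exclusive end of the block containing [i]. *)
Definition block_ends (d : nat) (e : 'I_d -> nat) : Prop :=
  (forall i : 'I_d, i < e i <= d) /\
  (forall i j : 'I_d, i <= j < e i -> e j = e i).

Lemma interval_decomp_ends (d : nat) (B : seq {set 'I_d}) :
  interval_decomp B -> exists2 e, block_ends e
    & forall i j : 'I_d, i < j -> same_block B i j = (j < e i).
Proof.
case=> b [_ b_path b_last ->].
(* The first breakpoint exceeding [i]; the default of [nth] is not reached when [i] is below the
   last breakpoint. *)
pose e (s : seq nat) (i : nat) := nth 0 s (find (fun n => i < n) s).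
have e_bound s m i : path ltn m s -> i < last m s -> m <= i -> i < e s i <= last m s.
  elim: s m => [|n s IHs] m /=; first by lia.
  case/andP=> lt_mn s_path lt_i le_i; rewrite /e /=.
  case: (ltnP i n) => [lt_in|le_ni] /=; last exact: IHs.
  rewrite lt_in /=.
  have [//|le_n] := leqP n (last n s).
  move: le_n; elim: (s) (n) s_path => [|n' s' IH] n0 /=; first by rewrite ltnn.
  by case/andP=> lt_n0 /IH{}IH lt; have := IH; lia.
have e_stable s i j : i <= j < e s i -> e s j = e s i.
  elim: s => [|n s IHs]; rewrite /e /= ?nth_nil; first by lia.
  case: (ltnP i n) => [lt_in|le_ni] /=; first by move=> /andP[_ ->].
  by move=> lt_j; rewrite ltnNge (leq_trans le_ni) /=; [apply: IHs|case/andP: lt_j].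
have e_block s m (i j : 'I_d) : path ltn m s -> i < last m s -> m <= i -> i < j ->
    same_block (pairmap (fun m n => [set i : 'I_d | m <= i < n]) m s) i j = (j < e s i).
  elim: s m => [|n s IHs] m /=; first by lia.
  case/andP=> lt_mn s_path lt_i le_i lt_ij; rewrite /e /= !inE.
  case: (ltnP i n) => [lt_in|le_ni] /=; last first.
    by rewrite andbF /= -[RHS](IHs n).
  (* Here [i] lies before the breakpoint [n], so no later block contains it. *)
  have -> : same_block
     (pairmap (fun m n => [set i : 'I_d | m <= i < n]) n s) i j = false.
    elim: (s) (n) lt_in s_path => [//|n' s' IH] n0 /= lt_in /andP[lt_n0 s'_path].
    by rewrite IH ?(ltn_trans lt_in) // !inE leqNgt lt_in.
  by rewrite orbF; lia.
exists (fun i : 'I_d => e b i); first split=> [i|i j].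
- by have := @e_bound b 0 i b_path; rewrite b_last; apply.
- exact: e_stable.
by move=> i j lt_ij; apply: e_block; rewrite ?b_last.
Qed.

(** * Counting tableaux with prescribed separated counts *)

Lemma entry_count_lt (d : nat) (mu : seq nat) (T : {ffun cell mu -> 'I_d})
    (r : nat) (Q : pred 'I_d) : entry_count T r Q < #|cell mu|.+1.
Proof. exact: max_card. Qed.

Lemma card_ord_leq (m n : nat) : #|[pred a : 'I_m | a <= n]| <= n.+1.
Proof.
rewrite cardE -(size_map val) -[leqRHS](size_iota 0).
apply: uniq_leq_size; first by rewrite (map_inj_uniq val_inj) enum_uniq.
by move=> y /mapP[a]; rewrite mem_enum inE => le_a ->; rewrite mem_iota.
Qed.

Lemma card_family_prod (I J : finType) (Q : I -> pred J) :
  #|family Q| = \prod_i #|Q i|.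
Proof.
rewrite -sum1_card.
under [RHS]eq_bigr do rewrite -sum1_card.
rewrite bigA_distr_big_dep; apply: eq_big => [f|f _]; last by rewrite big1_eq.
by apply/familyP/familyP.
Qed.

(** The value is fixed to [ord0] off the separated pairs, so that the possible count functions fill
    a box over which sums factor. [inord] truncates nothing, by [entry_count_lt]. *)
Definition sep_counts (d : nat) (mu : seq nat) (e : 'I_d -> nat)
    (T : {ffun cell mu -> 'I_d}) : {ffun 'I_d * 'I_d -> 'I_#|cell mu|.+1} :=
  [ffun p : 'I_d * 'I_d =>
     if e p.1 <= p.2 then inord (entry_count T p.1 (pred1 p.2)) else ord0].

Definition sep_row_sum (d n : nat) (e : 'I_d -> nat)
    (S : {ffun 'I_d * 'I_d -> 'I_n}) (j : 'I_d) : nat :=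
  \sum_(l < d | e j <= l) S (j, l).

(** On such a fibre the counts inside the blocks determine the tableau, and [ssyt_entry_count_le]
    confines each of them to an interval. The bound is the volume of the resulting box. *)
Lemma card_ssyt_sep_counts (d : nat) (mu : seq nat) (e : 'I_d -> nat)
    (S : {ffun 'I_d * 'I_d -> 'I_#|cell mu|.+1}) :
  is_part mu -> block_ends e ->
  #|[set T : {ffun cell mu -> 'I_d} | is_ssyt T && (sep_counts e T == S)]|
    <= \prod_(i < d) \prod_(j < d | i < j < e i)
         (nth 0 mu i - nth 0 mu j + sep_row_sum e S j).+1.
Proof.
move=> mu_part [e_bound e_stable]; set X := [set T | _].
pose bnd (i j : 'I_d) := nth 0 mu i - nth 0 mu j + sep_row_sum e S j.
pose refl (i k : 'I_d) : 'I_d := insubd i (i + (e i - k)).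
have reflE (i k : 'I_d) : i < k < e i -> refl i k = i + (e i - k) :> nat.
  by move=> lt_k; rewrite val_insubd; have := e_bound i; case: ifP; lia.
pose inblk (p : 'I_d * 'I_d) := p.1 < p.2 < e p.1.
pose box (p : 'I_d * 'I_d) : pred 'I_#|cell mu|.+1 :=
  [pred a : 'I_#|cell mu|.+1 | a <= if inblk p then bnd p.1 (refl p.1 p.2) else 0].
pose f (T : {ffun cell mu -> 'I_d}) : {ffun 'I_d * 'I_d -> 'I_#|cell mu|.+1} :=
  [ffun p : 'I_d * 'I_d => if inblk p then inord (entry_count T p.1 (pred1 p.2)) else ord0].
have f_inj : {in X &, injective f}.
  move=> T T'; rewrite !inE => /andP[T_ssyt /eqP ST] /andP[T'_ssyt /eqP ST'] eq_f.
  apply: ssyt_entry_count_inj => // r k lt_rk.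
  have lt_rd : r < d by exact: ltn_trans lt_rk (ltn_ord k).
  have eq_p (Z Z' : {ffun 'I_d * 'I_d -> 'I_#|cell mu|.+1}) :
      Z = Z' -> Z (Ordinal lt_rd, k) = Z' (Ordinal lt_rd, k) by move=> ->.
  have [le_e|lt_e] := leqP (e (Ordinal lt_rd)) k.
    move: (eq_p _ _ (etrans ST (esym ST'))); rewrite !ffunE /= le_e.
    by move/(congr1 val); rewrite /= !inordK ?entry_count_lt.
  move: (eq_p _ _ eq_f); rewrite !ffunE /inblk /= lt_rk lt_e.
  by move/(congr1 val); rewrite /= !inordK ?entry_count_lt.
rewrite -(card_in_imset f_inj).
have /leq_trans : #|f @: X| <= #|family box|.
  apply/subset_leq_card/subsetP => _ /imsetP[T + ->]; rewrite inE => /andP[T_ssyt /eqP def_S].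
  apply/familyP => -[i k]; rewrite inE /= ffunE; case: ifP => //= lt_k.
  rewrite inordK ?entry_count_lt //.
  apply: leq_trans (ssyt_entry_count_le mu_part T_ssyt lt_k) _.
  rewrite -reflE // leq_add2l /sep_row_sum -def_S.
  have -> : e (refl i k) = e i.
    by apply: e_stable; rewrite reflE //; move: lt_k; rewrite /inblk /=; lia.
  rewrite entry_count_sum leq_sum // => l le_l; rewrite ffunE /=.
  have -> : e (refl i k) = e i.
    by apply: e_stable; rewrite reflE //; move: lt_k; rewrite /inblk /=; lia.
  by rewrite inE in le_l; rewrite le_l inordK ?entry_count_lt.
apply; rewrite card_family_prod.
apply: leq_trans (_ : \prod_p (if inblk p then (bnd p.1 (refl p.1 p.2)).+1 else 1) <= _).
  apply: leq_prod => p _; apply: leq_trans (card_ord_leq _ _) _.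
  by case: ifP.
rewrite -big_mkcond -(pair_big_dep predT (fun i k : 'I_d => i < k < e i)
  (fun i k => (bnd i (refl i k)).+1)) /=.
apply/eq_leq/eq_bigr => i _.
have reflK (k : 'I_d) : i < k < e i -> refl i (refl i k) = k.
  by move=> lt_k; apply: val_inj; rewrite /= !reflE; lia.
(* The box is indexed by the entry [k], the claimed product by the row [j]; the involution matches
   them. *)
rewrite [RHS](reindex_onto (refl i) (refl i)) //; apply: eq_big => // k.
apply/idP/andP => [lt_k|[lt_k /eqP <-]]; last by rewrite reflE //; lia.
by rewrite reflK // reflE //; split=> //; lia.
Qed.

Local Open Scope ring_scope.

(** * Comparing the monomial of a tableau with the leading one *)

Lemma prod_nth_cells (R : comNzRingType) (d : nat) (mu : seq nat) (x : 'I_d -> R)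
    (h : (size mu <= d)%N) :
  \prod_(i < d) x i ^+ nth 0%N mu i = \prod_(c : cell mu) x (widen_ord h (tag c)).
Proof.
rewrite (partition_big (fun c : cell mu => widen_ord h (tag c)) predT) //=.
apply: eq_bigr => i _; rewrite -(card_row_cells mu i) -prodr_const.
apply: eq_big => c; rewrite !inE ?andTb -?val_eqE // => /eqP cr.
by congr x; apply: val_inj; rewrite /= -cr.
Qed.

(** The comparison is made cell by cell. An entry [k] in row [i] satisfies [k >= i], so
    [x k <= x i]; when [k] is beyond the block of [i], the exact factor [x k / x i] is kept, with
    [x i > x k >= 0]. *)
Lemma ssyt_monomial_le (R : realFieldType) (d : nat) (mu : seq nat)
    (x : 'I_d -> R) (e : 'I_d -> nat) (T : {ffun cell mu -> 'I_d}) :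
  is_part mu -> (size mu <= d)%N -> is_ssyt T ->
  (forall i, 0 <= x i) -> (forall i j : 'I_d, (i < j)%N -> x j < x i) ->
  (forall i : 'I_d, i < e i)%N ->
  \prod_(c : cell mu) x (T c) <= (\prod_(i < d) x i ^+ nth 0%N mu i) *
    \prod_(p : 'I_d * 'I_d | (e p.1 <= p.2)%N) (x p.2 / x p.1) ^+ sep_counts e T p.
Proof.
move=> mu_part le_size T_ssyt x_ge0 x_anti e_gt.
pose row (c : cell mu) : 'I_d := widen_ord le_size (tag c).
have -> : \prod_(p : 'I_d * 'I_d | (e p.1 <= p.2)%N)
    (x p.2 / x p.1) ^+ sep_counts e T p =
    \prod_(c : cell mu | (e (row c) <= T c)%N) (x (T c) / x (row c)).
  rewrite [RHS](partition_big (fun c => (row c, T c))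
    (fun p : 'I_d * 'I_d => (e p.1 <= p.2)%N)) //=.
  apply: eq_bigr => -[i k] /= le_k; rewrite ffunE /= le_k inordK ?entry_count_lt //.
  rewrite /entry_count -prodr_const; apply: eq_big => c.
    rewrite !inE xpair_eqE (_ : (cell_row c == i) = (row c == i)) //=.
    by apply/idP/idP => [/andP[/eqP-> /eqP->]|/and3P[_ -> ->] //]; rewrite le_k !eqxx.
  by rewrite !inE => /andP[/eqP cr /eqP->]; congr (_ / x _); apply: val_inj.
rewrite (prod_nth_cells x le_size) [X in _ * X]big_mkcond -big_split /=.
apply: ler_prod => c _; rewrite x_ge0 /= -/(row c); case: ifP => [le_T|_].
  rewrite mulrC divfK // gt_eqF // (le_lt_trans (x_ge0 (T c))) // x_anti //.
  exact: leq_trans (e_gt _) le_T.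
rewrite mulr1; have := ssyt_ge_row c mu_part T_ssyt.
rewrite leq_eqVlt => /orP[/eqP eq_c|lt_c]; last exact/ltW/x_anti.
by rewrite (_ : T c = row c) //; apply: val_inj.
Qed.

(** * Truncated geometric moments *)

Lemma bernoulli_ler (R : realFieldType) (x : R) (n : nat) :
  -1 <= x -> 1 + n%:R * x <= (1 + x) ^+ n.
Proof.
move=> x_ge; elim: n => [|n IHn]; first by rewrite mul0r addr0 expr0.
have n_ge0 : 0 <= n%:R :> R by exact: ler0n.
have : (1 + x) * (1 + n%:R * x) <= (1 + x) * (1 + x) ^+ n.
  by rewrite ler_wpM2l //; lra.
rewrite -exprS; apply: le_trans; rewrite -natr1; nra.
Qed.

Lemma geometric_sum_le (R : realFieldType) (q : R) (n : nat) :
  0 <= q -> q < 1 -> \sum_(a < n) q ^+ a <= (1 - q)^-1.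
Proof.
move=> q_ge0 q_lt1; have q1_gt0 : 0 < 1 - q by rewrite subr_gt0.
rewrite -[leRHS]mul1r ler_pdivlMr // mulrC.
have := subrX1 q n; have := exprn_ge0 n q_ge0; nra.
Qed.

(* By Bernoulli, 1 + a(1-q) is at most 2D (1+t)^a with t = (1-q)/(2D), and
   q (1+t)^D is still at distance (1-q)/2 from 1. *)
Lemma geometric_moment_le (R : realFieldType) (q : R) (D n : nat) :
  0 <= q -> q < 1 -> (0 < D)%N ->
  \sum_(a < n) q ^+ a * (1 + a%:R * (1 - q)) ^+ D
    <= (2 * D%:R) ^+ D * 2 * (1 - q)^-1.
Proof.
move=> q_ge0 q_lt1 D_gt0.
have D_ge1 : 1 <= D%:R :> R by rewrite ler1n.
set t := (1 - q) / (2 * D%:R).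
have tE : D%:R * t * 2 = 1 - q by rewrite /t; field; lra.
have t_gt0 : 0 < t by rewrite /t divr_gt0 //; lra.
(* Bernoulli at [- t] gives [1 - (1 - q) / 2 <= (1 - t) ^+ D], and [(1 + t) * (1 - t) <= 1]. *)
have tD_le : (1 + t) ^+ D * (1 - (1 - q) / 2) <= 1.
  have bern : 1 - (1 - q) / 2 <= (1 - t) ^+ D.
    have t_le1 : t <= 1 by nra.
    have := @bernoulli_ler R (- t) D; nra.
  apply: le_trans (_ : (1 + t) ^+ D * (1 - t) ^+ D <= 1).
    by rewrite ler_wpM2l // exprn_ge0 //; lra.
  by rewrite -exprMn exprn_ile1 //; nra.
set r := q * (1 + t) ^+ D.
have r_ge0 : 0 <= r by rewrite mulr_ge0 // exprn_ge0 //; lra.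
have r_le : r <= 1 - (1 - q) / 2.
  have p_ge0 : 0 <= (1 + t) ^+ D by rewrite exprn_ge0 //; lra.
  (* This is [q <= ((1 + q) / 2) ^+ 2]; one of the two factors then cancels against
     [(1 + t) ^+ D]. *)
  have : (1 + t) ^+ D * q <= (1 + t) ^+ D * (1 - (1 - q) / 2) ^+ 2.
    by rewrite ler_wpM2l //; nra.
  rewrite /r; nra.
apply: le_trans (_ : (2 * D%:R) ^+ D * \sum_(a < n) r ^+ a <= _).
  rewrite mulr_sumr; apply: ler_sum => a _.
  rewrite /r [(q * _) ^+ a]exprMn mulrCA ler_wpM2l ?exprn_ge0 //.
  rewrite exprAC -exprMn lerXn2r ?nnegrE //.
  - have : 0 <= a%:R :> R by exact: ler0n.
    nra.
  - by rewrite mulr_ge0 ?exprn_ge0 //; lra.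
  have := @bernoulli_ler R t a ltac:(lra).
  have : 0 <= a%:R :> R by exact: ler0n.
  nra.
rewrite -mulrA ler_wpM2l //; first by rewrite exprn_ge0 //; lra.
apply: le_trans (geometric_sum_le n r_ge0 _) _; first lra.
rewrite -[2 in leRHS]invrK -invfM lef_pV2 ?posrE; lra.
Qed.

(** * From the fibre count to a bound on the Schur polynomial *)

Lemma prodr_1D_ge (R : realFieldType) (I : finType) (P : pred I) (y : I -> R) :
  (forall i, P i -> 0 <= y i) ->
  1 + \sum_(i | P i) y i <= \prod_(i | P i) (1 + y i).
Proof.
move=> y_ge0.
suff: 0 <= \sum_(i | P i) y i /\ 1 + \sum_(i | P i) y i <= \prod_(i | P i) (1 + y i).
  by case.
elim/big_rec2: _ => [|i u v /y_ge0 yi_ge0 [v_ge0 le_uv]]; first by rewrite addr0.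
by split; nra.
Qed.

(** The strictness, due to the shift by [d - i], absorbs the [.+1] in the fibre count. *)
Lemma shifted_sub_gt (d : nat) (mu : seq nat) (i j : 'I_d) :
  is_part mu -> (i < j)%N ->
  (nth 0 mu i - nth 0 mu j + shifted mu j < shifted mu i)%N.
Proof.
move=> mu_part lt_ij; have := part_nth_anti mu_part (ltnW lt_ij).
by rewrite /shifted; have := ltn_ord i; have := ltn_ord j; lia.
Qed.

(** Meant for [eps = 1 - q]. Since [1 <= N * eps], each row sum is at most [N * sigma], and [sigma]
    is absorbed by the product of the [1 + S p * eps p], once for each pair [i < j] in a block. *)
Lemma fiber_bound_le (R : realFieldType) (d n : nat) (mu : seq nat)
    (e : 'I_d -> nat) (N : R) (eps : 'I_d * 'I_d -> R)
    (S : {ffun 'I_d * 'I_d -> 'I_n}) :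
  is_part mu -> 0 <= N ->
  (forall p : 'I_d * 'I_d, (e p.1 <= p.2)%N -> 0 <= eps p /\ 1 <= N * eps p) ->
  (\prod_(i < d) \prod_(j < d | (i < j < e i)%N)
      (nth 0 mu i - nth 0 mu j + sep_row_sum e S j).+1)%N%:R
    <= (\prod_(i < d) \prod_(j < d | (i < j < e i)%N)
          ((shifted mu i)%:R - (shifted mu j)%:R + N))
       * (\prod_(p : 'I_d * 'I_d | (e p.1 <= p.2)%N) (1 + (S p)%:R * eps p))
           ^+ (d * d) :> R.
Proof.
move=> mu_part N_ge0 eps_ge; set H := \prod_(p | _) (1 + _).
set sigma := \sum_(p : 'I_d * 'I_d | (e p.1 <= p.2)%N) (S p)%:R * eps p.
have term_ge0 (p : 'I_d * 'I_d) : (e p.1 <= p.2)%N -> 0 <= (S p)%:R * eps p.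
  by case/eps_ge=> eps_ge0 _; rewrite mulr_ge0.
have sigma_ge0 : 0 <= sigma by apply: sumr_ge0.
have H_ge : 1 + sigma <= H by apply: prodr_1D_ge.
have c_le j : (sep_row_sum e S j)%:R <= N * sigma.
  have -> : sigma = \sum_(i < d) \sum_(k < d | (e i <= k)%N) (S (i, k))%:R * eps (i, k).
    by rewrite pair_big_dep /=; apply: eq_bigr => -[].
  rewrite /sep_row_sum natr_sum [in leRHS](bigD1 j) //= mulrDr.
  rewrite -[leLHS]addr0 lerD //; last first.
    by rewrite mulr_ge0 // sumr_ge0 // => i _; rewrite sumr_ge0 // => k; apply: (term_ge0 (i, k)).
  rewrite mulr_sumr; apply: ler_sum => l le_l.
  have [_ eps1] := eps_ge (j, l) le_l; rewrite mulrCA.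
  by rewrite -[leLHS]mulr1 ler_wpM2l.
rewrite natr_prod; under eq_bigr do rewrite natr_prod.
rewrite !(pair_big_dep predT (fun i j : 'I_d => (i < j < e i)%N)) /=.
(* One copy of [H] per pair of indices allows a factorwise comparison; as [H >= 1], the surplus
   copies do no harm. *)
have -> : H ^+ (d * d) = \prod_(p : 'I_d * 'I_d) H.
  by rewrite prodr_const card_prod card_ord.
rewrite [leLHS]big_mkcond [X in X * _]big_mkcond -big_split /=.
apply: ler_prod => -[i j] _ /=; case: ifP => [/andP[lt_ij _]|_]; last first.
  by rewrite ler01 mul1r; lra.
have := shifted_sub_gt mu_part lt_ij; rewrite -(ler_nat R) -natr1 natrD.
move: (_ - _)%N => u le_u; rewrite ler0n -natr1 natrD.
have u_ge0 : 0 <= u%:R :> R by exact: ler0n.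
have := c_le j.
suff : ((shifted mu i)%:R - (shifted mu j)%:R + N) * (1 + sigma) <=
   ((shifted mu i)%:R - (shifted mu j)%:R + N) * H :> R by nra.
by rewrite ler_wpM2l //; lra.
Qed.

(** The tableaux are grouped by their separated counts, on which the retained weight depends alone.
    [K] is the constant of [geometric_moment_le] for the exponent [d * d], spent once per pair of
    indices. *)
Lemma schur_le (R : realFieldType) (d : nat) (mu : seq nat) (x : 'I_d -> R)
    (e : 'I_d -> nat) (N : R) (K := (2 * (d * d)%:R) ^+ (d * d) * 2 : R) :
  (0 < d)%N -> is_part mu -> (size mu <= d)%N -> block_ends e ->
  (forall i, 0 <= x i) -> (forall i j : 'I_d, (i < j)%N -> x j < x i) ->
  0 <= N -> (forall i j : 'I_d, (e i <= j)%N -> x i / (x i - x j) <= N) ->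
  schur mu x <= (\prod_(i < d) x i ^+ nth 0%N mu i) *
    (K ^+ (d * d) * (\prod_(i < d) \prod_(j < d | (i < j < e i)%N)
          ((shifted mu i)%:R - (shifted mu j)%:R + N))
        * (\prod_(i < d) \prod_(j < d | (e i <= j)%N) (x i / (x i - x j)))).
Proof.
move=> d_gt0 mu_part le_size e_ends x_ge0 x_anti N_ge0 N_ge.
have e_gt (i : 'I_d) : (i < e i)%N by have [/(_ i)/andP[]] := e_ends.
set MN := \prod_(i < d) \prod_(j < d | (i < j < e i)%N) _.
pose q (p : 'I_d * 'I_d) := x p.2 / x p.1.
pose sep (p : 'I_d * 'I_d) := (e p.1 <= p.2)%N.
have x_gt0 p : sep p -> 0 < x p.1.
  move=> sep_p; apply: le_lt_trans (x_ge0 p.2) _; apply: x_anti.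
  exact: leq_trans (e_gt _) sep_p.
have sep_anti p : sep p -> x p.2 < x p.1.
  by move=> sep_p; apply: x_anti; exact: leq_trans (e_gt _) sep_p.
have q_ge0 p : 0 <= q p by rewrite divr_ge0.
have q_lt1 p : sep p -> q p < 1.
  by move=> sep_p; rewrite ltr_pdivrMr ?x_gt0 // mul1r sep_anti.
have ratioE p : sep p -> (1 - q p)^-1 = x p.1 / (x p.1 - x p.2).
  move=> sep_p; have := x_gt0 p sep_p; have := sep_anti p sep_p => lt_x x1_gt0.
  rewrite /q; field; rewrite !gt_eqF ?subr_gt0 //; lra.
have K_ge1 : 1 <= K.
  rewrite -[1]mulr1 ler_pM ?exprn_ege1 //; last by lra.
  have : 1 <= (d * d)%:R :> R by rewrite ler1n muln_gt0 d_gt0.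
  lra.
pose W (S : {ffun 'I_d * 'I_d -> 'I_#|cell mu|.+1}) :=
  \prod_(p | sep p) q p ^+ S p.
pose box (p : 'I_d * 'I_d) := [pred a : 'I_#|cell mu|.+1 | sep p || (a == ord0)].
have W_ge0 S : 0 <= W S by rewrite prodr_ge0 // => p _; rewrite exprn_ge0.
apply: le_trans (_ : \sum_(T : {ffun cell mu -> 'I_d} | is_ssyt T)
  (\prod_(i < d) x i ^+ nth 0%N mu i) * W (sep_counts e T) <= _).
  by apply: ler_sum => T T_ssyt; apply: ssyt_monomial_le.
rewrite -mulr_sumr ler_wpM2l ?prodr_ge0 // => [i _|]; first by rewrite exprn_ge0.
rewrite (partition_big (sep_counts e) (mem (family box))) /=; last first.
  move=> T _; apply/familyP => p; rewrite inE ffunE /sep.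
  by case: ifP.
apply: le_trans (_ : \sum_(S in family box) MN * \prod_p (if sep p then
    q p ^+ S p * (1 + (S p)%:R * (1 - q p)) ^+ (d * d) else 1) <= _).
  apply: ler_sum => S _.
  set X := [set T : {ffun cell mu -> 'I_d} | is_ssyt T && (sep_counts e T == S)].
  have -> : \sum_(T : {ffun cell mu -> 'I_d} | is_ssyt T && (sep_counts e T == S))
      W (sep_counts e T) = #|X|%:R * W S.
    rewrite mulr_natl -sumr_const; apply: eq_big => [T|T /andP[_ /eqP->] //].
    by rewrite inE.
  rewrite -big_mkcond big_split -/(W S) /= [W S * _]mulrC mulrA ler_wpM2r // prodrXl.
  have := card_ssyt_sep_counts S mu_part e_ends; rewrite -/X -(ler_nat R).
  move=> /le_trans; apply; apply: fiber_bound_le => // p sep_p.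
  have q1_gt0 : 0 < 1 - q p by rewrite subr_gt0 q_lt1.
  split; first exact: ltW.
  (* The condition [1 <= N * (1 - q p)] says exactly that [N] dominates the ratio of the pair. *)
  rewrite -ler_pdivrMr // mul1r ratioE //; exact: N_ge.
have MN_ge0 : 0 <= MN.
  rewrite prodr_ge0 // => i _; rewrite prodr_ge0 // => j /andP[lt_ij _].
  have := shifted_sub_gt mu_part lt_ij; rewrite -(ltr_nat R) natrD.
  have : 0 <= (nth 0%N mu i - nth 0%N mu j)%:R :> R by exact: ler0n.
  lra.
rewrite -mulr_sumr [K ^+ _ * MN]mulrC -mulrA ler_wpM2l //.
(* The sum over the box of products becomes a product over pairs of one-variable sums. *)
rewrite -(bigA_distr_big_dep (fun p => box p)
  (fun p a => if sep p then q p ^+ a * (1 + a%:R * (1 - q p)) ^+ (d * d) else 1)).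
have -> : K ^+ (d * d) = \prod_(p : 'I_d * 'I_d) K.
  by rewrite prodr_const card_prod card_ord.
rewrite (pair_big_dep predT (fun i j : 'I_d => (e i <= j)%N)) /=.
rewrite [X in _ * X]big_mkcond -big_split /=.
apply: ler_prod => p _; rewrite -/(sep p).
have [sep_p|nsep_p] := boolP (sep p); last first.
  (* A pair that is not separated admits only the count 0 and contributes 1, which is at most
     [K]. *)
  by rewrite (big_pred1 ord0) // ler01 mulr1.
rewrite /=.
have q1_gt0 : 0 < 1 - q p by rewrite subr_gt0 q_lt1.
rewrite sumr_ge0 => [|a _]; last first.
  by rewrite mulr_ge0 ?exprn_ge0 // addr_ge0 // mulr_ge0 // ltW.
rewrite -ratioE //; apply: geometric_moment_le => //; first exact: q_lt1.
by rewrite muln_gt0 d_gt0.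
Qed.

(** * Specialisation to the shifted parts and [Nmax] *)

Lemma Nmax_ge0 (R : realFieldType) (d : nat) (ell : 'I_d -> R) (B : seq {set 'I_d}) :
  0 <= Nmax ell B.
Proof. exact: bigmax_ge_id. Qed.

Lemma ratio_le_Nmax (R : realFieldType) (d : nat) (ell : 'I_d -> R)
    (B : seq {set 'I_d}) (i j : 'I_d) :
  (i < j)%N -> ~~ same_block B i j -> ell i / (ell i - ell j) <= Nmax ell B.
Proof.
move=> lt_ij sep_ij; apply: le_trans (le_bigmax _ _ i).
by apply: (le_bigmax_cond _ (fun j => ell i / (ell i - ell j))); rewrite lt_ij.
Qed.

Unset Implicit Arguments.

Theorem theorem8p4 (R : realFieldType) (d : nat) (hd : (2 <= d)%N) :
  exists C : R, 0 < C /\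
  forall (la mu : seq nat) (B : seq {set 'I_d}),
    is_part la -> is_part mu -> (size la <= d)%N -> (size mu <= d)%N ->
    part_incl mu la -> interval_decomp B ->
    let ell := fun i : 'I_d => (shifted la i)%:R : R in
    let m := fun i : 'I_d => (shifted mu i)%:R : R in
    schur mu ell / \prod_(i < d) ell i ^+ nth 0%N mu i <=
      C * (\prod_(i < d) \prod_(j < d | (i < j)%N && same_block B i j)
             (m i - m j + Nmax ell B))
        * (\prod_(i < d) \prod_(j < d | (i < j)%N && ~~ same_block B i j)
             (ell i / (ell i - ell j))).
Proof.
have d_gt0 : (0 < d)%N by exact: ltnW.
exists (((2 * (d * d)%:R) ^+ (d * d) * 2) ^+ (d * d)); split.
  by rewrite exprn_gt0 // mulr_gt0 // exprn_gt0 // mulr_gt0 // ltr0n muln_gt0 d_gt0.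
move=> la mu B la_part mu_part _ le_size mu_la B_dec; lazy zeta.
set ell : 'I_d -> R := fun i => (shifted la i)%:R.
have [e e_ends e_block] := interval_decomp_ends B_dec.
have e_gt (i : 'I_d) : (i < e i)%N by have [/(_ i)/andP[]] := e_ends.
have ell_anti (i j : 'I_d) : (i < j)%N -> ell j < ell i.
  by move=> /(shifted_sub_gt la_part); rewrite ltr_nat; apply: leq_ltn_trans; rewrite leq_addl.
have sepE (i j : 'I_d) : ((i < j)%N && ~~ same_block B i j) = (e i <= j)%N.
  have [lt_ij|le_ji] := ltnP i j; first by rewrite e_block // -leqNgt.
  by apply/esym/negbTE; rewrite -ltnNge; apply: leq_ltn_trans (e_gt i).
have blkE (i j : 'I_d) : ((i < j)%N && same_block B i j) = (i < j < e i)%N.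
  by have [lt_ij|//] := ltnP i j; rewrite e_block.
(* The last [ell i] can vanish, but then [mu_la] forces the exponent to be 0 and the factor is 1. *)
have prod_gt0 : 0 < \prod_(i < d) ell i ^+ nth 0%N mu i.
  apply: prodr_gt0 => i _.
  have [/eqP->|ell_n0] := boolP (nth 0%N mu i == 0%N); first by rewrite expr0.
  rewrite exprn_gt0 // ltr0n /shifted; have := mu_la i; lia.
rewrite ler_pdivrMr // [leRHS]mulrC.
under [X in _ * (_ * X * _)]eq_bigr do under eq_bigl do rewrite blkE.
under [X in _ * (_ * _ * X)]eq_bigr do under eq_bigl do rewrite sepE.
apply: schur_le => // [|i j]; first exact: Nmax_ge0.
by rewrite -sepE => /andP[lt_ij]; apply: ratio_le_Nmax.
Qed.
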